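(* Let $P\subset\mathbb{R}^d$ be a lattice polytope with vertex set $A$ and let $\Delta$ be a unimodular triangulation of $P$ (with vertices in $A$). Then for all integers $t\ge 1$ and all $y\in tP\cap\mathbb{Z}^d$, there is exactly one $F\in\mathcal{F}_t(y)$ such that $\operatorname{conv}(F)$ is a simplex belonging to $\Delta$.
   Context: Let $P=\operatorname{conv}(A)$ be a lattice polytope with vertex set $A=\{v_1,\ldots,v_N\}\subset\mathbb{Z}^d$. For an integer $t\ge1$ and $y\in tP\cap\mathbb{Z}^d$, a level-$t$ decomposition of $y$ is an equality $y=a_1v_{i_1}+\cdots+a_rv_{i_r}$ with $a_j\in\mathbb{Z}_{>0}$, $\sum_{j=1}^r a_j=t$, and $v_{i_1},\ldots,v_{i_r}$ pairwise distinct vertices in $A$. The support of this decomposition is the set $F=\{v_{i_1},\ldots,v_{i_r}\}$. The set of all supports of level-$t$ decompositions of $y$ is denoted $\mathcal{F}_t(y)$. To say that $\Delta$ contains the convex hull of a support $F$ as a face means that $\operatorname{conv}(F)$ is a simplex of $\Delta$ with vertex set $F$. A triangulation of a finite point configuration $A$ is a set $\Delta$ of simplices with vertices in $A$ that is closed under taking faces, whose union is $\operatorname{conv}(A)$, and such that distinct simplices of $\Delta$ have disjoint relative interiors. It is unimodular if every maximal simplex has normalized lattice volume $1$ with respect to the lattice $\operatorname{aff}(P)\cap\mathbb{Z}^d$ (equivalently, every lattice point of $\operatorname{aff}(P)$ is an integer affine combination of the vertices of the simplex). *)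

(* Defs.v *)
From HB Require Import structures.
From mathcomp Require Import all_boot all_order all_algebra finmap.
From mathcomp Require Import all_classical all_reals all_analysis.

Set Implicit Arguments.
Unset Strict Implicit.
Unset Printing Implicit Defensive.

Import Order.TTheory GRing.Theory Num.Theory.
Import numFieldNormedType.Exports.

Local Open Scope classical_set_scope.
Local Open Scope ring_scope.

Definition embZ (R : realType) (d : nat) (v : 'rV[int]_d) : 'rV[R]_d :=
  map_mx intr v.
Arguments embZ R {d} v.

Definition conv_hull (R : realType) (d : nat) (F : {fset 'rV[int]_d}) :
    set 'rV[R]_d :=
  [set x | exists c : 'rV[int]_d -> R,
     [/\ forall v, v \in F -> 0 <= c v,
         \sum_(v <- F) c v = 1
       & x = \sum_(v <- F) c v *: embZ R v]].
Arguments conv_hull R {d} F _.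

Definition aff_hull (R : realType) (d : nat) (C : set 'rV[R]_d) : set 'rV[R]_d :=
  [set x | exists (n : nat) (p : 'I_n -> 'rV[R]_d) (c : 'I_n -> R),
     [/\ forall i, C (p i),
         \sum_(i < n) c i = 1
       & x = \sum_(i < n) c i *: p i]].

Definition relint (R : realType) (d : nat) (C : set 'rV[R]_d) :
    set 'rV[R]_d :=
  [set x | C x /\ \forall z \near x, aff_hull C z -> C z].

(* Vertices as zero-dimensional faces: the unique maximizer over P of some
   linear functional. *)
Definition vertices (R : realType) (d : nat) (P : set 'rV[R]_d) :
    set 'rV[R]_d :=
  [set x | P x /\ exists c : 'cV[R]_d,
     forall z, P z -> z <> x -> (z *m c) 0 0 < (x *m c) 0 0].

Definition lattice_polytope (R : realType) (d : nat) (P : set 'rV[R]_d)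
    (A : {fset 'rV[int]_d}) : Prop :=
  P = conv_hull R A /\ vertices P = embZ R @` [set` A].

Definition aff_indep (R : realType) (d : nat) (F : {fset 'rV[int]_d}) : Prop :=
  forall c : 'rV[int]_d -> R,
    \sum_(v <- F) c v = 0 -> \sum_(v <- F) c v *: embZ R v = 0 ->
    forall v, v \in F -> c v = 0.
Arguments aff_indep R {d} F.

Definition simplex_on (R : realType) (d : nat) (F : {fset 'rV[int]_d})
    (S : set 'rV[R]_d) : Prop :=
  aff_indep R F /\ S = conv_hull R F.

(* Simplices are geometric sets, and only closure under nonempty faces is
   required, so the empty simplex may or may not belong to Delta. *)
Definition triangulation (R : realType) (d : nat) (A : {fset 'rV[int]_d})
    (Delta : set (set 'rV[R]_d)) : Prop :=
  [/\ forall S, Delta S -> exists2 F, (F `<=` A)%fset & simplex_on F S,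
      forall S F G, Delta S -> simplex_on F S -> (G `<=` F)%fset -> G != fset0 ->
        Delta (conv_hull R G),
      \bigcup_(S in Delta) S = conv_hull R A
    & trivIset Delta (@relint R d)].

Definition lattice_points (R : realType) (d : nat) (C : set 'rV[R]_d) :
    set 'rV[int]_d :=
  [set z | C (embZ R z)].

(* The rows of B form a basis of the free group of differences of the affine
   lattice L. *)
Definition affine_lattice_basis (d k : nat) (L : set 'rV[int]_d)
    (B : 'M[int]_(k, d)) : Prop :=
  (forall w : 'rV[int]_k, w *m B = 0 -> w = 0) /\
  (forall p, L p -> L = [set p + w *m B | w in [set: 'rV[int]_k]]).

(* [normalized_volume L F m]: k! times the volume, measured in units of a
   fundamental cell of L, of the k-simplex with vertex set F = {p_0, ..., p_k}
   is m.  This is |det M|, where the rows of M are the coordinates of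
   p_i - p_0 in a lattice basis; k is the rank of L, so the relation only
   concerns simplices of full dimension with respect to L. *)
Definition normalized_volume (d : nat) (L : set 'rV[int]_d)
    (F : {fset 'rV[int]_d}) (m : nat) : Prop :=
  exists (k : nat) (B : 'M[int]_(k, d)) (p : 'I_k.+1 -> 'rV[int]_d)
         (M : 'M[int]_k),
    [/\ affine_lattice_basis L B,
        injective p /\ range p = [set` F],
        forall i, p (lift ord0 i) - p ord0 = row i M *m B
      & `|\det M|%N = m].

Definition maximal_simplex (R : realType) (d : nat)
    (Delta : set (set 'rV[R]_d)) (S : set 'rV[R]_d) : Prop :=
  Delta S /\ forall T, Delta T -> S `<=` T -> T = S.

Definition unimodular (R : realType) (d : nat) (P : set 'rV[R]_d)
    (Delta : set (set 'rV[R]_d)) : Prop :=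
  forall S F, maximal_simplex Delta S -> simplex_on F S ->
    normalized_volume (lattice_points (aff_hull P)) F 1.

Definition dilate (R : realType) (d t : nat) (P : set 'rV[R]_d) :
    set 'rV[R]_d :=
  [set t%:R *: x | x in P].

Definition supports (d : nat) (A : {fset 'rV[int]_d}) (t : nat)
    (y : 'rV[int]_d) : set {fset 'rV[int]_d} :=
  [set F | (F `<=` A)%fset /\ exists a : 'rV[int]_d -> nat,
     [/\ forall v, v \in F -> (0 < a v)%N,
         (\sum_(v <- F) a v)%N = t
       & y = \sum_(v <- F) v *+ a v]].

(* Main.v *)
(* Write [x = y / t].  If [y] has a level-[t] decomposition with support [F]
   and [conv F] is a simplex of [Delta], then [x] lies in the relative interior
   of [conv F]; since relative interiors of simplices of [Delta] are disjoint,
   [conv F] and hence its vertex set [F] are determined by [y].  Conversely [x]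
   lies in some maximal simplex of [Delta]; by unimodularity its vertices
   [p_0, ..., p_k] are such that [y - t p_0] is an integer combination of the
   differences [p_i - p_0], so [y] is an integer combination of the [p_i] with
   total weight [t].  These weights are [t] times the barycentric coordinates
   of [x], so they are nonnegative and the positive ones span the required
   face. *)
Require Import Defs.
From mathcomp Require Import all_boot all_order all_algebra finmap.
From mathcomp Require Import all_classical all_reals all_analysis.

Set Implicit Arguments.
Unset Strict Implicit.
Unset Printing Implicit Defensive.

Import Order.TTheory GRing.Theory Num.Theory.
Import numFieldNormedType.Exports.

Local Open Scope classical_set_scope.
Local Open Scope ring_scope.

Section Simplices.
Variables (R : realType) (d : nat).
Implicit Types (F G A : {fset 'rV[int]_d}) (v w u : 'rV[int]_d).

(** * Integer vectors in real space and sums over finite sets *)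

Lemma embZ_inj : injective (embZ R (d := d)).
Proof.
move=> u v /rowP uv; apply/rowP => j.
by have := uv j; rewrite !mxE => /intr_inj.
Qed.

Lemma embZ_sum (I : Type) (s : seq I) (f : I -> 'rV[int]_d) :
  embZ R (\sum_(i <- s) f i) = \sum_(i <- s) embZ R (f i).
Proof.
elim: s => [|i s IH]; first by rewrite !big_nil /embZ map_mx0.
by rewrite !big_cons -IH /embZ map_mxD.
Qed.

Lemma embZ_scale (a : int) v : embZ R (a *: v) = a%:~R *: embZ R v.
Proof. exact: map_mxZ. Qed.

Lemma big_fset_only1 (V : nmodType) F v (f : 'rV[int]_d -> V) : v \in F ->
    (forall w, w \in F -> w != v -> f w = 0) ->
  \sum_(w <- F) f w = f v.
Proof.
move=> vF f0; rewrite (big_fsetD1 v) //= big_seq big1 ?addr0 // => w.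
by rewrite in_fsetD1 => /andP[wv wF]; exact: f0.
Qed.

Lemma sum_indicator F v : v \in F -> \sum_(w <- F) (w == v)%:R = 1 :> R.
Proof.
by move=> vF; rewrite (big_fset_only1 vF) ?eqxx // => w _ /negPf->.
Qed.

Lemma sum_indicator_scale F v : v \in F ->
  \sum_(w <- F) (w == v)%:R *: embZ R w = embZ R v.
Proof.
move=> vF; rewrite (big_fset_only1 vF) ?eqxx ?scale1r // => w _ /negPf->.
by rewrite scale0r.
Qed.

Lemma conv_hull_vertex F v : v \in F -> conv_hull R F (embZ R v).
Proof.
move=> vF; exists (fun w => (w == v)%:R); split.
- by move=> w _; exact: ler0n.
- exact: sum_indicator.
- by rewrite sum_indicator_scale.
Qed.

Lemma aff_hull_sub (C : set 'rV[R]_d) : C `<=` aff_hull C.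
Proof.
move=> x Cx; exists 1%N, (fun=> x), (fun=> 1).
by split=> //; rewrite big_ord1 ?scale1r.
Qed.

(** * Affine independence and barycentric coordinates *)

Lemma aff_indep_coord_inj F (a b : 'rV[int]_d -> R) :
    aff_indep R F -> \sum_(v <- F) a v = \sum_(v <- F) b v ->
    \sum_(v <- F) a v *: embZ R v = \sum_(v <- F) b v *: embZ R v ->
  forall v, v \in F -> a v = b v.
Proof.
move=> iF ab1 ab2 v vF; apply/eqP; rewrite -subr_eq0; apply/eqP.
apply: (iF (fun v => a v - b v)) => //.
  by rewrite sumrB ab1 subrr.
under eq_bigr do rewrite scalerBl.
by rewrite sumrB ab2 subrr.
Qed.

Lemma aff_indep_sub F G : (G `<=` F)%fset -> aff_indep R F -> aff_indep R G.
Proof.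
move=> GF iF c c1 c2 v vG.
(* Extension of the coefficients by zero turns a relation on [G] into one on [F]. *)
pose c' w := if w \in G then c w else 0.
have c'E : c' v = c v by rewrite /c' vG.
rewrite -c'E; apply: iF; last exact: (fsubsetP GF).
  rewrite -(big_fset_incl _ GF) => [|w _ /negPf wG]; last by rewrite /c' wG.
  by rewrite -[RHS]c1 big_seq [RHS]big_seq; apply: eq_bigr => w wG; rewrite /c' wG.
rewrite -(big_fset_incl _ GF) => [|w _ /negPf wG]; last first.
  by rewrite /c' wG scale0r.
by rewrite -[RHS]c2 big_seq [RHS]big_seq; apply: eq_bigr => w wG; rewrite /c' wG.
Qed.

(** Affine independence of [F] says that the rows [(w, 1)] of the matrix [W] are linearly
    independent, so [W] has a right inverse. Its column indexed by [v] supplies the linear part [a]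
    and, in the last entry, the constant [b]. *)
Lemma barycentric_functional F v : aff_indep R F -> v \in F ->
  exists (a : 'cV[R]_d) (b : R), forall w, w \in F ->
    (embZ R w *m a) 0 0 + b = (w == v)%:R.
Proof.
move=> iF vF.
pose e (i : 'I_(size F)) := nth 0 F i.
have eF i : e i \in F by exact: mem_nth.
have e_inj : injective e.
  by move=> i j /eqP; rewrite /e nth_uniq ?fset_uniq // => /eqP/val_inj.
have sumF (V : nmodType) (f : 'rV[int]_d -> V) :
    \sum_(w <- F) f w = \sum_i f (e i).
  by rewrite (big_nth 0) big_mkord.
pose E : 'M[R]_(size F, d) := \matrix_i embZ R (e i).
pose W : 'M[R]_(size F, d + 1) := row_mx E (const_mx 1).
have Wfree : row_free W.
  apply/inj_row_free => u.
  rewrite mul_mx_row -[X in _ = X -> _]row_mx0 => /eq_row_mx[uE u1].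
  (* The row [u] is transported along the injective enumeration [e] to a function on vectors, the
     form that [aff_indep] expects. *)
  pose c w := \sum_(i | e i == w) u 0 i.
  have cE i : c (e i) = u 0 i.
    by rewrite /c (eq_bigl (pred1 i)) ?big_pred1_eq // => j /=; rewrite (inj_eq e_inj).
  apply/rowP => i; rewrite mxE -cE; apply: iF => //.
    rewrite sumF; under eq_bigr do rewrite cE.
    move/matrixP/(_ 0 0): u1; rewrite !mxE => u1; rewrite -[RHS]u1.
    by apply: eq_bigr => j _; rewrite mxE mulr1.
  rewrite sumF -[RHS]uE mulmx_sum_row; apply: eq_bigr => j _.
  by rewrite cE rowK.
have /row_freeP[W'] := Wfree.
rewrite -(vsubmxK W') mul_row_col; move: (usubmx W') (dsubmx W') => U V UV.
pose iv := Ordinal (etrans (index_mem v F) vF).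
have eiv : e iv = v by rewrite /e nth_index.
exists (col iv U), (V 0 iv) => w wF.
pose iw := Ordinal (etrans (index_mem w F) wF).
have eiw : e iw = w by rewrite /e nth_index.
move/matrixP/(_ iw iv): UV; rewrite !mxE big_ord1 !mxE mul1r.
rewrite -(inj_eq e_inj) eiw eiv => <-; congr (_ + _).
by apply: eq_bigr => j _; rewrite !mxE eiw.
Qed.

(** An affine form commutes with affine combinations. The coefficients may be negative, so this also
    reads off coordinates of points of the affine hull outside the simplex. *)
Lemma barycentric_functionalE F v (a : 'cV[R]_d) b (c : 'rV[int]_d -> R) :
    v \in F ->
    (forall w, w \in F -> (embZ R w *m a) 0 0 + b = (w == v)%:R) ->
    \sum_(w <- F) c w = 1 ->
  ((\sum_(w <- F) c w *: embZ R w) *m a) 0 0 + b = c v.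
Proof.
move=> vF ab c1; rewrite -[b]mul1r -c1 mulmx_suml summxE mulr_suml -big_split /=.
rewrite (big_fset_only1 vF) => [|w wF wv]; rewrite -scalemxAl mxE -mulrDr ab //.
  by rewrite eqxx mulr1.
by rewrite (negPf wv) mulr0.
Qed.

Lemma aff_hull_conv_hull F z : aff_hull (conv_hull R F) z ->
  exists2 g : 'rV[int]_d -> R, \sum_(v <- F) g v = 1
    & z = \sum_(v <- F) g v *: embZ R v.
Proof.
move=> [n [p [c [pF c1 ->]]]].
have [e eP] := choice pF.
exists (fun v => \sum_(i < n) c i * e i v).
  rewrite exchange_big /= -[RHS]c1; apply: eq_bigr => i _.
  by have [_ e1 _] := eP i; rewrite -mulr_sumr e1 mulr1.
under [RHS]eq_bigr do rewrite scaler_suml.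
rewrite exchange_big /=; apply: eq_bigr => i _.
have [_ _ {1}->] := eP i.
by rewrite scaler_sumr; apply: eq_bigr => v _; rewrite scalerA.
Qed.

(** * Relative interiors of simplices *)

Lemma affine_form_continuous (a : 'cV[R]_d) (b : R) :
  continuous (fun z : 'rV[R]_d => (z *m a) 0 0 + b).
Proof.
under eq_fun do rewrite mxE.
move=> z; apply: continuousD; last exact: cst_continuous.
move: z; apply: continuous_big; first exact: add_continuous.
move=> j _ z; apply: continuousM; first exact: coord_continuous.
exact: cst_continuous.
Qed.

(** The barycentric coordinates extend to continuous affine forms on the whole space. Being positive
    at the given point, they stay positive nearby, and a nearby point of the affine hull is then a
    convex combination of [F]. *)
Lemma relint_simplex F (c : 'rV[int]_d -> R) : aff_indep R F ->
    (forall v, v \in F -> 0 < c v) -> \sum_(v <- F) c v = 1 ->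
  relint (conv_hull R F) (\sum_(v <- F) c v *: embZ R v).
Proof.
move=> iF c0 c1; split; first by exists c; split=> // v /c0/ltW.
set x := \sum_(v <- F) _.
(* The value [(0, 0)] outside [F] is a filler that makes the choice of forms total. *)
have : forall v, exists ab : 'cV[R]_d * R, v \in F -> forall w, w \in F ->
    (embZ R w *m ab.1) 0 0 + ab.2 = (w == v)%:R.
  move=> v; have [vF|vF] := boolP (v \in F); last by exists (0, 0).
  by have [a [b ab]] := barycentric_functional iF vF; exists (a, b).
move=> /choice[ab abP].
have : nbhs x (\bigcap_(v in [set` F])
    [set z | 0 < (z *m (ab v).1) 0 0 + (ab v).2]).
  apply: filter_bigI => v vF.
  have := @affine_form_continuous (ab v).1 (ab v).2 x.
  rewrite /continuous_at (barycentric_functionalE vF (abP v vF) c1).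
  by move/cvgr_gt => /(_ 0 (c0 v vF)).
apply: filterS => z zP /aff_hull_conv_hull[g g1 zE].
exists g; split=> // v vF; apply: ltW.
by rewrite -(barycentric_functionalE vF (abP v vF) g1) -zE; exact: zP.
Qed.

(** * Recovering the vertex set from the simplex *)

(** A vertex [v] of a simplex is an extreme point: if it is a convex combination of points of [G],
    each lying in the simplex, then every point carrying nonzero weight equals [v]. *)
Lemma simplex_vertices_sub F G : aff_indep R F ->
  conv_hull R F = conv_hull R G -> (F `<=` G)%fset.
Proof.
move=> iF FG; apply/fsubsetP => v vF.
have [g [g0 g1 vE]] : conv_hull R G (embZ R v) by rewrite -FG; exact: conv_hull_vertex.
have : forall u, exists f : 'rV[int]_d -> R, u \in G ->
    [/\ forall w, w \in F -> 0 <= f w, \sum_(w <- F) f w = 1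
      & embZ R u = \sum_(w <- F) f w *: embZ R w].
  move=> u; have [uG|uG] := boolP (u \in G); last by exists (fun=> 0).
  have : conv_hull R F (embZ R u) by rewrite FG; exact: conv_hull_vertex.
  by move=> [f fP]; exists f.
move=> /choice[f fP].
have hE w : w \in F -> \sum_(u <- G) g u * f u w = (w == v)%:R.
  move: w; apply: aff_indep_coord_inj => //.
    rewrite exchange_big /= sum_indicator // -[RHS]g1.
    rewrite big_seq [RHS]big_seq; apply: eq_bigr => u uG.
    by have [_ f1 _] := fP u uG; rewrite -mulr_sumr f1 mulr1.
  rewrite sum_indicator_scale //.
  under eq_bigr do rewrite scaler_suml.
  rewrite vE exchange_big /= big_seq [RHS]big_seq; apply: eq_bigr => u uG.
  have [_ _ ->] := fP u uG; rewrite scaler_sumr.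
  by apply: eq_bigr => w _; rewrite scalerA.
have [u uG gu] : exists2 u, u \in G & g u != 0.
  apply/not_exists2P => g00; have := @oner_neq0 R; rewrite -g1 big_seq big1 ?eqxx // => u uG.
  by have [//|/negP/negPn/eqP] := g00 u.
have [f0 f1 fE] := fP u uG.
(* The coordinate of [v] at [w] is 0 and is a sum of nonnegative terms [g u * f u w], so each term
   vanishes. *)
have fu w : w \in F -> w != v -> f u w = 0.
  move=> wF wv; have /eqP := hE w wF.
  rewrite (negPf wv) big_seq psumr_eq0; last first.
    by move=> u' u'G; rewrite mulr_ge0 ?g0 //; have [->] := fP u' u'G.
  move=> /allP/(_ u uG); rewrite uG /= mulf_eq0 (negPf gu) /=.
  by move/eqP.
suff -> : v = u by [].
apply: embZ_inj; rewrite fE (big_fset_only1 vF) => [|w wF wv]; last first.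
  by rewrite fu // scale0r.
by move: f1; rewrite (big_fset_only1 vF) // => ->; rewrite scale1r.
Qed.

Lemma simplex_vertices_inj F G : simplex_on F (conv_hull R F) ->
  simplex_on G (conv_hull R G) -> conv_hull R F = conv_hull R G -> F = G.
Proof.
move=> [iF _] [iG _] FG; apply/eqP; rewrite eqEfsubset.
by rewrite !simplex_vertices_sub.
Qed.

(** * Maximal simplices *)

Lemma exists_maximal_simplex A (Delta : set (set 'rV[R]_d)) S :
    triangulation A Delta -> Delta S ->
  exists2 T, maximal_simplex Delta T & S `<=` T.
Proof.
move=> [DA _ _ _].
(* Induction on the number of subsets of [A] whose hull contains [S]. It drops when [S] is replaced
   by a strictly larger [T] in [Delta], since the vertex set of [S] is counted for [S] but not for
   [T]. It is never 0 on [Delta], for the same reason. *)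
pose m (S : set 'rV[R]_d) :=
  #|` [fset G in fpowerset A | `[< (S `<=` conv_hull R G)%classic >]]%fset|.
move: {2}(m S) (leqnn (m S)) => n; elim: n S => [|n IH] S.
  rewrite leqn0 cardfs_eq0 => /eqP m0 DS; have [F FA [_ SF]] := DA _ DS.
  have : F \in [fset G in fpowerset A | `[< (S `<=` conv_hull R G)%classic >]]%fset.
    by rewrite !inE /= fpowersetE FA; apply/asboolP; rewrite SF.
  by rewrite m0 inE.
move=> mS DS.
have [maxS|] := pselect (maximal_simplex Delta S); first by exists S.
move=> /not_andP[//|/existsNP[T /not_implyP[DT /not_implyP[ST TS]]]].
have [U maxU TU] : exists2 U, maximal_simplex Delta U & T `<=` U.
  apply: IH => //; rewrite -ltnS; apply: leq_trans mS.
  apply: fproper_ltn_card; rewrite fproperE; apply/andP; split.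
    apply/fsubsetP => G; rewrite !inE /= => /andP[-> /asboolP TG] /=.
    by apply/asboolP; exact: subset_trans TG.
  have [F FA [_ SF]] := DA _ DS; apply/negP => /fsubsetP/(_ F).
  rewrite !inE /= fpowersetE FA -SF /= => /(_ (asboolT _))/asboolP.
  by move=> /(_ (@subset_refl _ _)) TS'; apply: TS; apply/seteqP.
by exists U => //; exact: subset_trans TU.
Qed.

(** * Integer coordinates from unimodularity *)

(** Normalized volume 1 makes [M] invertible over the integers, so the edge vectors from [p ord0]
    generate the same difference lattice as the rows of [B]. *)
Lemma unimodular_integer_coords (P : set 'rV[R]_d) F (t : nat) y :
    (forall v, v \in F -> P (embZ R v)) ->
    normalized_volume (lattice_points (aff_hull P)) F 1 ->
    lattice_points (dilate t P) y ->
  exists2 b : 'rV[int]_d -> int, \sum_(v <- F) b v = t%:Z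
    & y = \sum_(v <- F) b v *: v.
Proof.
move=> FP [k [B [p [M [[_ LB] [pinj prange] pM /eqP detM]]]]] [x Px xy].
have pF i : p i \in F.
  by have : range p (p i) by []; rewrite prange.
have sumF (V : nmodType) (f : 'rV[int]_d -> V) :
    \sum_(w <- F) f w = \sum_i f (p i).
  rewrite -(big_map p xpredT f); apply: perm_big; apply: uniq_perm.
  - exact: fset_uniq.
  - by rewrite map_inj_uniq // index_enum_uniq.
  move=> v; apply/idP/mapP => [vF|[i _ ->]] //.
  have : [set` F] v by [].
  by rewrite -prange => -[i _ <-]; exists i; rewrite ?mem_index_enum.
have Mu : M \in unitmx by rewrite unitmxE; case: (\det M) detM => [[|[|?]]|[|?]].
have Lp : lattice_points (aff_hull P) (p ord0).
  by apply: aff_hull_sub; exact: FP.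
(* The point [y] lies in the dilate, not necessarily in the affine hull of [P]. Subtracting [t - 1]
   copies of [p ord0] gives the affine combination [t x + (1 - t) p_0], which does lie there. *)
have : lattice_points (aff_hull P) (y - (t%:Z - 1) *: p ord0).
  exists 2%N, (fun i => if i == 0 then x else embZ R (p ord0)),
    (fun i => if i == 0 then t%:R else 1 - t%:R); split.
  - by move=> i; case: ifP => // _; exact: FP.
  - by rewrite !big_ord_recl big_ord0 /= addr0 addrCA subrr addr0.
  - rewrite !big_ord_recl big_ord0 /= addr0 xy.
    by rewrite -[1 - _]opprB scaleNr /embZ map_mxB map_mxZ rmorphB rmorph1.
rewrite (LB _ Lp) => -[w _ wE].
pose u := w *m invmx M.
have yE : y = t%:Z *: p ord0 + \sum_i u 0 i *: (p (lift ord0 i) - p ord0).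
  have -> : \sum_i u 0 i *: (p (lift ord0 i) - p ord0) = w *m B.
    under eq_bigr do rewrite pM scalemxAl.
    by rewrite -mulmx_suml -mulmx_sum_row /u mulmxKV.
  move/eqP: wE; rewrite eq_sym subr_eq => /eqP ->.
  by rewrite addrAC scalerBl scale1r addrCA subrr addr0.
(* The vertex [p ord0] receives the weight left over by the others, so that the total is [t]. *)
pose bb (i : 'I_k.+1) : int :=
  if unlift ord0 i is Some j then u 0 j else t%:Z - \sum_j u 0 j.
pose b v := \sum_(i | p i == v) bb i.
have bE i : b (p i) = bb i.
  by rewrite /b (eq_bigl (pred1 i)) ?big_pred1_eq // => j /=; rewrite (inj_eq pinj).
have bb0 : bb ord0 = t%:Z - \sum_j u 0 j by rewrite /bb unlift_none.
have bbS j : bb (lift ord0 j) = u 0 j by rewrite /bb liftK.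
exists b.
  rewrite sumF big_ord_recl bE; under eq_bigr do rewrite bE bbS.
  by rewrite bb0 subrK.
rewrite sumF big_ord_recl bE; under eq_bigr do rewrite bE bbS.
rewrite bb0 {1}yE; under [X in _ + X = _]eq_bigr do rewrite scalerBr.
by rewrite sumrB scalerBl scaler_suml [RHS]addrAC -addrA.
Qed.

(** The multiplicities divided by [t] are positive and sum to 1. *)
Lemma supports_relint A F (t : nat) y : (0 < t)%N -> aff_indep R F ->
  supports A t y F -> relint (conv_hull R F) (t%:R^-1 *: embZ R y).
Proof.
move=> t0 iF [_ [a [a0 asum ->]]].
have tR : (t%:R : R) != 0 by rewrite pnatr_eq0 -lt0n.
have -> : t%:R^-1 *: embZ R (\sum_(v <- F) v *+ a v) =
    \sum_(v <- F) (t%:R^-1 * (a v)%:R) *: embZ R v.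
  rewrite embZ_sum scaler_sumr; apply: eq_bigr => v _.
  by rewrite -[v *+ _]scaler_nat embZ_scale scalerA rmorph_nat.
apply: relint_simplex => //.
  by move=> v /a0 av; rewrite mulr_gt0 // ?invr_gt0 ltr0n.
by rewrite -mulr_sumr -natr_sum asum mulVf.
Qed.

End Simplices.

(** * Existence and uniqueness of the simplicial support *)

Theorem lemma4p2 (R : realType) (d : nat) (P : set 'rV[R]_d)
    (A : {fset 'rV[int]_d}) (Delta : set (set 'rV[R]_d))
    (hP : lattice_polytope P A) (hDelta : triangulation A Delta)
    (hU : unimodular P Delta) :
  forall (t : nat) (y : 'rV[int]_d), (1 <= t)%N ->
    lattice_points (dilate t P) y ->
    exists! F : {fset 'rV[int]_d},
      supports A t y F /\ Delta (conv_hull R F) /\ simplex_on F (conv_hull R F).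
Proof.
move=> t y t1 yP; have [PA _] := hP; have [DA Dface Dcover Ddisj] := hDelta.
have tR : (t%:R : R) != 0 by rewrite pnatr_eq0 -lt0n.
apply/unique_existence; split; last first.
  (* Uniqueness: the point [y / t] lies in both relative interiors, so the two simplices coincide,
     and with them their vertex sets. *)
  move=> F G [FS [DF sF]] [GS [DG sG]].
  apply: (simplex_vertices_inj sF sG); apply: Ddisj => //.
  exists (t%:R^-1 *: embZ R y); split.
    exact: supports_relint t1 sF.1 FS.
  exact: supports_relint t1 sG.1 GS.
have [x Px xy] := yP.
have [S DS Sx] : (\bigcup_(S in Delta) S) x by rewrite Dcover -PA.
have [T maxT ST] := exists_maximal_simplex hDelta DS.
have [F FA sT] := DA _ maxT.1; have [iF TF] := sT.
have FP v : v \in F -> P (embZ R v).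
  by move=> vF; rewrite PA; apply: conv_hull_vertex; exact: (fsubsetP FA).
have [b b1 yE] := unimodular_integer_coords FP (hU _ _ maxT sT) yP.
have [c [c0 c1 xE]] : conv_hull R F x by rewrite -TF; exact: ST.
(* Both [b] and [t c] express [y = t x] over [F] with total weight [t], and such coordinates are
   unique. *)
have bc v : v \in F -> (b v)%:~R = t%:R * c v.
  move: v; apply: aff_indep_coord_inj => //.
    by rewrite -mulr_sumr c1 mulr1 -rmorph_sum b1.
  transitivity (embZ R y).
    by rewrite yE embZ_sum; apply: eq_bigr => v _; rewrite embZ_scale.
  rewrite -xy xE scaler_sumr; apply: eq_bigr => v _.
  by rewrite scalerA.
have b0 v : v \in F -> 0 <= b v.
  by move=> vF; rewrite -(ler0z R) bc // mulr_ge0 ?ler0n ?c0.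
(* Decompositions use positive multiplicities only, so the vertices of weight 0 are dropped. *)
pose G := [fset v in F | 0 < b v]%fset.
have GF : (G `<=` F)%fset by apply/fsubsetP => v; rewrite !inE => /andP[].
have bG v : v \in F -> v \notin G -> b v = 0.
  move=> vF; rewrite !inE vF /= => /negP bv; apply/eqP.
  by rewrite eq_le b0 // andbT leNgt; apply/negP.
have bGpos v : v \in G -> (b v = `|b v|%N).
  by rewrite !inE => /andP[vF _]; rewrite gez0_abs // b0.
exists G; split; last split.
- split; first exact: fsubset_trans FA.
  exists (fun v => `|b v|%N); split.
  + by move=> v; rewrite !inE absz_gt0 => /andP[_ /lt0r_neq0].
  + apply/eqP; rewrite -eqz_nat -b1 -(big_fset_incl _ GF bG) /=.
    rewrite -[X in X == _]natz natr_sum big_seq [X in _ == X]big_seq.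
    by apply/eqP; apply: eq_bigr => v vG; rewrite natz -bGpos.
  + rewrite yE -(big_fset_incl _ GF) /=; last by move=> v vF /bG->; rewrite ?scale0r.
    rewrite big_seq [RHS]big_seq; apply: eq_bigr => v vG.
    by rewrite {1}bGpos // -natz scaler_nat.
- apply: (Dface T F) => //; first exact: maxT.1.
  (* The face is nonempty: an empty [G] would make the total weight [t] equal to 0. *)
  apply/negP => /eqP G0; move: b1; rewrite -(big_fset_incl _ GF bG) /= G0.
  by rewrite big_seq_fset0 => -[t0]; rewrite -t0 in t1.
- by split=> //; exact: aff_indep_sub GF iF.
Qed.
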